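(* Let $d>4$, let $F_d$ be the free group on generators $a_1,\ldots,a_d$, and let $\mu_d$ be the uniform probability measure on $\{a_1^{\pm1},\ldots,a_d^{\pm1}\}$. Then $(F_d,\mu_d)$ is not algebraically recurrent: there is $n$ such that with positive probability $\mathcal{S}_n\neq F_d$.
   Context: A $\mu$-random walk is $X_n=\zeta_1\cdots\zeta_n$ with $\zeta_i$ i.i.d. of law $\mu$; $\mathcal{S}_n$ denotes the semigroup generated by $\{X_n,X_{n+1},\ldots\}$. $(G,\mu)$ is algebraically recurrent if for every $n$, $\mathcal{S}_n=G$ almost surely. *)

(* Defs.v *)
From HB Require Import structures.
From mathcomp Require Import all_boot all_order all_algebra.
From mathcomp Require Import all_classical all_reals all_analysis.
Set Implicit Arguments. Unset Strict Implicit. Unset Printing Implicit Defensive.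
Import Order.TTheory GRing.Theory Num.Theory.

(* Free group F_d on generators a_0..a_{d-1}: letters (i, false) = a_i,
   (i, true) = a_i^{-1}; elements are freely reduced words; the product is
   concatenation followed by free reduction (stack-based). *)
Definition letter (d : nat) := ('I_d * bool)%type.
Definition linv d (x : letter d) : letter d := (x.1, ~~ x.2).

Definition reduced d (s : seq (letter d)) : bool :=
  sorted (fun x y => y != linv x) s.

Definition red_cons d (x : letter d) (acc : seq (letter d)) : seq (letter d) :=
  match acc with
  | y :: t => if y == linv x then t else x :: acc
  | [::] => [:: x]
  end.

Definition reduce d (s : seq (letter d)) : seq (letter d) :=
  foldr (@red_cons d) [::] s.

Definition fmul d (u v : seq (letter d)) : seq (letter d) := reduce (u ++ v).

(* X_n = zeta_1 ... zeta_n (steps indexed from 0 here: zeta 0, ..., zeta (n-1)) *)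
Definition walk d (T : Type) (zeta : nat -> T -> letter d) (n : nat) (w : T)
  : seq (letter d) :=
  reduce [seq zeta i w | i <- iota 0 n].

Definition in_semigroup d (gen : nat -> seq (letter d)) (n : nat)
  (g : seq (letter d)) : Prop :=
  exists ks : seq nat, ks != [::] /\ all (fun k => n <= k)%N ks /\
    g = foldr (@fmul d) [::] [seq gen k | k <- ks].

(* Main.v *)
Require Import Defs.
From HB Require Import structures.
From mathcomp Require Import all_boot all_order all_algebra.
From mathcomp Require Import all_classical all_reals all_analysis.
From mathcomp Require Import zify ring lra.
Import Order.TTheory GRing.Theory Num.Theory.
Set Implicit Arguments. Unset Strict Implicit. Unset Printing Implicit Defensive.
Local Open Scope classical_set_scope.
Local Open Scope ring_scope.

(** Almost surely there is an n such that no product of X_k's with k >= n is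
    trivial. Almost surely |X_k| >= k/4 eventually. The crux is that, writing
    m = l/36, eventually X_l cancels fewer than m letters against any
    product s of late X_k's. By induction on the number of factors, a prefix u
    of s with m letters equals X_{k_1} ... X_{k_r} p with k_1 + ... + k_r <= 8m
    and p a prefix, of length at most m, of some X_k: each factor loses only a
    small fraction of its length, so passing X_k uses up at least k/8 letters.
    Since X_k moves away at linear speed, p can be read off X_{8m}, hence u only
    depends on the first 8m steps. If u^-1 is a suffix of X_l then the path
    visited X_l u at some time j >= 8m, and the steps j, ..., l-1 multiply to
    u^-1, which has probability at most 3^-m given the past. For large k_i there
    are at most 2 * 2^m choices of (k_1, ..., k_r), so these events have a
    summable probability, and Borel-Cantelli applies. *)

(** * Reduced words *)

Section FreeGroup.
Variable d : nat.
Implicit Types (x y : letter d) (r s t u v : seq (letter d)).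

Lemma linvK : involutive (@linv d).
Proof. by case=> i b; rewrite /linv /= negbK. Qed.

Definition winv s := rev [seq linv x | x <- s].

Lemma winv_cons x s : winv (x :: s) = rcons (winv s) (linv x).
Proof. by rewrite /winv /= rev_cons. Qed.

Lemma winvK : involutive winv.
Proof. by move=> s; rewrite /winv map_rev revK mapK //; exact: linvK. Qed.

Lemma winv_cat s t : winv (s ++ t) = winv t ++ winv s.
Proof. by rewrite /winv map_cat rev_cat. Qed.

Lemma size_winv s : size (winv s) = size s.
Proof. by rewrite size_rev size_map. Qed.

Lemma reduced_cons x s :
  reduced (x :: s) = (if s is y :: _ then y != linv x else true) && reduced s.
Proof. by case: s. Qed.

Lemma reduced_behead x s : reduced (x :: s) -> reduced s.
Proof. by rewrite reduced_cons => /andP[]. Qed.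

Lemma reduced_catr s t : reduced (s ++ t) -> reduced t.
Proof. by elim: s => //= x s IH /reduced_behead. Qed.

Lemma reduced_catl s t : reduced (s ++ t) -> reduced s.
Proof.
elim: s => // x s IH; rewrite cat_cons !reduced_cons => /andP[h /IH ->].
by rewrite andbT; case: s h {IH}.
Qed.

Lemma reduced_red_cons x s : reduced s -> reduced (red_cons x s).
Proof.
case: s => // y s /= h; case: ifPn => [_|hy]; first exact: reduced_behead h.
by rewrite reduced_cons hy.
Qed.

Lemma reduced_reduce s : reduced (reduce s).
Proof. by elim: s => //= x s; exact: reduced_red_cons. Qed.

Lemma reduce_id s : reduced s -> reduce s = s.
Proof.
elim: s => // x s IH; rewrite reduced_cons => /andP[h /IH] /= ->.
by case: s h {IH} => //= y s /negbTE ->.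
Qed.

Lemma red_consK x s : reduced s -> red_cons x (red_cons (linv x) s) = s.
Proof.
case: s => [|y s]; first by rewrite /= eqxx.
rewrite reduced_cons /= linvK => /andP[h _].
case: eqP h => [->|_] h; last by rewrite /= eqxx.
by case: s h => //= z s /negbTE ->.
Qed.

(** Letters act on reduced words through [red_cons], and inverse letters act as inverse maps, so
    cancelling inside [s] does not change its action. Associativity of [fmul] follows. *)
Lemma foldr_red_cons s t :
  reduced t -> foldr (@red_cons d) t (reduce s) = foldr (@red_cons d) t s.
Proof.
move=> rt; elim: s => //= x s <-.
have red_act u : reduced (foldr (@red_cons d) t u).
  by elim: u => //= y u; exact: reduced_red_cons.
case: (reduce s) => //= y u; case: eqP => //= ->.
by rewrite red_consK.
Qed.

Lemma reduce_catr s t : reduce (s ++ reduce t) = reduce (s ++ t).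
Proof. by rewrite /reduce !foldr_cat -/(reduce _) reduce_id ?reduced_reduce. Qed.

Lemma reduce_catl s t : reduce (reduce s ++ t) = reduce (s ++ t).
Proof.
rewrite /reduce !foldr_cat -/(reduce t) -/(reduce s).
by rewrite foldr_red_cons // reduced_reduce.
Qed.

Lemma fmulA s t u : fmul s (fmul t u) = fmul (fmul s t) u.
Proof. by rewrite /fmul reduce_catr reduce_catl catA. Qed.

Lemma reduced_fmul s t : reduced (fmul s t).
Proof. exact: reduced_reduce. Qed.

Lemma fmul0s s : reduced s -> fmul [::] s = s.
Proof. exact: reduce_id. Qed.

Lemma reduce_winv_catK s t : reduce (winv s ++ s ++ t) = reduce t.
Proof.
elim: s => //= x s IH; rewrite winv_cons cat_rcons -IH -reduce_catr -[RHS]reduce_catr.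
congr reduce; congr (_ ++ _) => /=.
by rewrite -{2}(linvK x) red_consK // reduced_reduce.
Qed.

(** [B] is the block of [s] that cancels. Since [s] is reduced, a letter put in front of it can
    cancel only when [A] is still empty. *)
Lemma fmul_cancel s t : reduced s -> exists A B C,
  [/\ s = A ++ B, t = winv B ++ C & foldr (@red_cons d) t s = A ++ C].
Proof.
elim: s => [|x s IH] rs; first by exists [::], [::], t.
have [[|y A] [B [C [es et /= ->]]]] := IH (reduced_behead rs).
  rewrite /= in es; rewrite {s IH}es in rs *.
  case: C et => [|z C] et; first by exists [:: x], B, [::].
  rewrite /=; case: eqP => [ez|_]; last by exists [:: x], B, (z :: C).
  by exists [::], (x :: B), C; rewrite winv_cons cat_rcons -ez.
exists (x :: y :: A), B, C; split => //=; first by rewrite es.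
by move: rs; rewrite es reduced_cons /= => /andP[/negbTE ->].
Qed.

Lemma fmul_decomp s t : reduced s -> reduced t -> exists A B C,
  [/\ s = A ++ B, t = winv B ++ C & fmul s t = A ++ C].
Proof.
move=> rs rt; have [A [B [C [es et eC]]]] := fmul_cancel t rs.
by exists A, B, C; split=> //; rewrite /fmul /reduce foldr_cat -/(reduce t) reduce_id.
Qed.

Lemma size_red_cons x s : (size (red_cons x s) <= (size s).+1)%N.
Proof. by case: s => //= y s; case: ifP => //= _; lia. Qed.

Lemma size_reduce s : (size (reduce s) <= size s)%N.
Proof. by elim: s => //= x s IH; apply: leq_trans (size_red_cons _ _) _. Qed.

(** A step of the walk either erases the last letter or appends one. *)
Lemma reduce_rcons_decomp s x : reduced s -> exists A B C,
  [/\ s = A ++ B, reduce (rcons s x) = A ++ C & (size B + size C = 1)%N].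
Proof.
move=> rs; have [//|A [B [C [es et eC]]]] := fmul_decomp (t := [:: x]) rs.
exists A, B, C; split=> //; first by rewrite -cats1 -eC.
by move/(congr1 size): et; rewrite size_cat size_winv.
Qed.

End FreeGroup.

(** * Cancellation along a path *)

Section Deterministic.
Variable d : nat.
Implicit Types (r s t u v : seq (letter d)) (ks : seq nat).

(* All lists with entries at least 60 and sum at most M, provided fuel > M; the
   bound 60 makes the growth rate in M at most 13/12, and (13/12)^8 <= 2. *)
Fixpoint lists_up_to (fuel M : nat) : seq (seq nat) :=
  if fuel is f.+1 then
    [::] :: flatten [seq [seq k :: ks | ks <- lists_up_to f (M - k)]
                    | k <- iota 60 (M.+1 - 60)]
  else [::].

Lemma mem_lists_up_to f M ks : (size ks < f)%N ->
  all (fun k => 60 <= k)%N ks -> (sumn ks <= M)%N -> ks \in lists_up_to f M.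
Proof.
elim: f M ks => // f IH M [|k ks] /=; first by rewrite inE eqxx.
rewrite ltnS => sf /andP[hk hks] hs; rewrite inE; apply/orP; right.
apply/flatten_mapP; exists k; first by rewrite mem_iota; lia.
by apply: map_f; apply: IH => //; lia.
Qed.

(** The walk as a function of a finite word [s] of steps, so that events become predicates on words
    and probabilities become averages. *)
Definition wlk s k := reduce (take k s).
Definition wlk_prod s ks := foldr (@fmul d) [::] [seq wlk s k | k <- ks].
Definition wlk_word s ks k i := fmul (wlk_prod s ks) (take i (wlk s k)).

Definition slow (l : nat) s := (4 * size (reduce s) < l)%N.

(* The word u is computed from the first j letters only, so that it is
   independent of [drop j s]. *)
Definition hit m ks k i j s :=
  let u := wlk_word (take j s) ks k i in
  (size u == m) && (reduce (drop j s) == winv u).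

Definition bad l s :=
  let m := (l %/ 36)%N in
  has (fun ks => has (fun k => has (fun i => has (fun j => hit m ks k i j s)
    (iota 0 l.+1)) (iota 0 m.+1)) (iota 0 (8 * m).+1))
    (lists_up_to (8 * m).+1 (8 * m)).

End Deterministic.

Section Path.
Variables (d : nat) (z : nat -> letter d).
Implicit Types (u v : seq (letter d)) (ks : seq nat).
Let W (k : nat) := [seq z i | i <- iota 0 k].
Let X k := reduce (W k).
Let Xprod ks := foldr (@fmul d) [::] [seq X k | k <- ks].

Let take_W j l : (j <= l)%N -> take j (W l) = W j.
Proof. by move=> jl; rewrite /W -map_take take_iota; congr map; congr iota; lia. Qed.

Let X_S k : X k.+1 = reduce (rcons (X k) (z k)).
Proof.
by rewrite /X /W -addn1 iotaD map_cat /= -[rcons _ _]cats1 reduce_catl.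
Qed.

Let redX k : reduced (X k). Proof. exact: reduced_reduce. Qed.

(** The Cayley graph is a tree: a step changes only the end of the word, so the path to [X l] passes
    through each of its prefixes. *)
Lemma visit_prefix l p q : X l = p ++ q -> exists2 j, (j <= l)%N & X j = p.
Proof.
elim: l p q => [|l IH] p q e; first by exists 0%N => //; case: p e.
have [A [B [C [eA eS sBC]]]] := reduce_rcons_decomp (z l) (redX l).
move: e; rewrite X_S eS => e.
have [pA|Ap] := leqP (size p) (size A).
  have eAp : A = p ++ drop (size p) A.
    have -> : p = take (size p) A.
      by rewrite -(takel_cat C pA) e take_size_cat.
    by rewrite size_takel // cat_take_drop.
  have [j jl ej] : exists2 j, (j <= l)%N & X j = p.
    by apply: (IH _ (drop (size p) A ++ B)); rewrite catA -eAp.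
  by exists j => //; lia.
(* Here [p] is longer than [A] and [C] has at most one letter, so [q] is empty. *)
exists l.+1 => //; rewrite X_S eS e.
have : size q = 0%N by move/(congr1 size): e; rewrite !size_cat; lia.
by move/size0nil ->; rewrite cats0.
Qed.

Lemma size_X k : (size (X k) <= k)%N.
Proof. by apply: leq_trans (size_reduce _) _; rewrite size_map size_iota. Qed.

(** In each step one of [B], [C] is empty, so the length bounds before and after it put the first
    [i] letters inside the part [A] that is kept. *)
Lemma take_X_stable i K k : (K <= k)%N ->
  (forall k', (K <= k')%N -> (i <= size (X k'))%N) -> take i (X k) = take i (X K).
Proof.
move=> Kk h; rewrite -(subnKC Kk); elim: (k - K)%N => [|t IH]; first by rewrite addn0.
rewrite -IH addnS X_S.
have [A [B [C [eA eS sBC]]]] := reduce_rcons_decomp (z (K + t)) (redX (K + t)).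
have h1 := h (K + t)%N (leq_addr _ _).
have := h (K + t).+1 (leqW (leq_addr _ _)); rewrite X_S eS.
rewrite eA in h1 *; rewrite !size_cat in h1 * => h2.
by rewrite !takel_cat //; lia.
Qed.

Lemma reduced_Xprod ks : reduced (Xprod ks).
Proof. by case: ks => //= k ks; exact: reduced_fmul. Qed.

Lemma wlk_prod_W j ks : all (fun k => k <= j)%N ks -> wlk_prod (W j) ks = Xprod ks.
Proof.
move=> /allP h; rewrite /wlk_prod /Xprod; congr foldr; apply/eq_in_map => k /h kj.
by rewrite /wlk take_W.
Qed.

Variable n0 : nat.
Hypothesis fast : forall l, (n0 <= l)%N -> ~~ slow l (W l).
Hypothesis good : forall l, (n0 <= l)%N -> ~~ bad l (W l).

Variable n : nat.
(** The entries in [lists_up_to] start at 60, and [5 * n0] ensures [n0 <= 8 * (l %/ 36)] for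
    [l >= n]. *)
Hypothesis n_large : (60 + 5 * n0 <= n)%N.

Let speed l : (n0 <= l)%N -> (l <= 4 * size (X l))%N.
Proof. by move/fast; rewrite /slow -leqNgt. Qed.

(** The bound on [sumn ks] limits the number of candidates for [u]. No upper bound on [k] is
    imposed, because [take_X_stable] can lower it later. *)
Let prefix_form u := exists ks k i,
  [/\ all (fun k => n <= k)%N ks, (n0 <= k)%N, (sumn ks <= 8 * size u)%N,
      (i <= size u)%N & u = fmul (Xprod ks) (take i (X k))].

Let mem_le_sumn k ks : k \in ks -> (k <= sumn ks)%N.
Proof. by elim: ks => //= a ks IH; rewrite inE => /orP[/eqP->|/IH]; lia. Qed.

Let size_le_sumn ks : all (fun k => n <= k)%N ks -> (size ks <= sumn ks)%N.
Proof. by elim: ks => //= a ks IH /andP[h /IH]; lia. Qed.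

Lemma prefix_form_not_suffix l p u : (n <= l)%N -> prefix_form u ->
  size u = (l %/ 36)%N -> X l <> p ++ winv u.
Proof.
move=> nl [ks [k [i [hks hk hs hi eu]]]]; set m := (l %/ 36)%N => su eX.
have n0l : (n0 <= l)%N by lia.
have ml : (36 * m <= l)%N by rewrite /m; lia.
have ml' : (n0 <= 8 * m)%N by rewrite /m; lia.
(* From time [8 * m] on the walk has length at least [2 * m], so the first [i <= m] letters of [X k]
   are already those of [X (8 * m)]. *)
wlog k8 : k hk eu / (k <= 8 * m)%N.
  move=> Hw; have [/Hw|k8] := leqP k (8 * m); first by apply.
  apply: (Hw (8 * m)%N) => //.
  rewrite [u in LHS]eu; congr fmul; apply: take_X_stable; first exact: ltnW.
  by move=> k' hk'; have := @speed k'; lia.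
have sX : (size p + m = size (X l))%N by rewrite eX size_cat size_winv su.
have lX := speed n0l.
have [j jl ej] := visit_prefix eX.
(* This fixes [36 = 4 * (8 + 1)]: [X l] has at least [9 * m] letters, hence [p] at least [8 * m],
   and reaching [p] takes as many steps. *)
have jm : (8 * m <= j)%N by have := size_X j; rewrite ej; lia.
have := good n0l; apply/negP; rewrite negbK /bad -/m.
apply/hasP; exists ks.
  apply: mem_lists_up_to; last by rewrite -su.
    by have := size_le_sumn hks; lia.
  by apply/allP => a /(allP hks); lia.
apply/hasP; exists k; first by rewrite mem_iota; lia.
apply/hasP; exists i; first by rewrite mem_iota; lia.
apply/hasP; exists j; first by rewrite mem_iota; lia.
have ew : wlk_word (take j (W l)) ks k i = u.
  rewrite take_W // /wlk_word wlk_prod_W; last first.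
    by apply/allP => a /mem_le_sumn; lia.
  by rewrite /wlk take_W -/(X k); last lia.
rewrite /hit ew su eqxx /=; apply/eqP.
have redu : reduced (winv u).
  by apply: (@reduced_catr _ p); rewrite -eX.
(* Cancel [X j] on the left: followed by the remaining steps or by [winv u], it gives [X l]. *)
rewrite -(reduce_id redu) -(reduce_winv_catK (X j)) -[RHS](reduce_winv_catK (X j)).
rewrite -reduce_catr -[RHS]reduce_catr; congr reduce; congr (_ ++ _).
rewrite {1}/X reduce_catl -(take_W jl) cat_take_drop -/(X l) eX ej reduce_id //.
by rewrite -eX.
Qed.

(** If [B] had [l %/ 36] letters or more, the inverse of its last [l %/ 36] letters would be a
    prefix of [Xprod ks], contradicting [prefix_form_not_suffix]. *)
Lemma Xprod_decomp l ks : (n <= l)%N ->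
  (forall u v, Xprod ks = u ++ v -> prefix_form u) -> exists A B C,
  [/\ X l = A ++ B, Xprod ks = winv B ++ C, Xprod (l :: ks) = A ++ C
    & (size B < l %/ 36)%N].
Proof.
move=> nl H; have [A [B [C [eA eC e]]]] := fmul_decomp (redX l) (reduced_Xprod ks).
exists A, B, C; split=> //; rewrite ltnNge; apply/negP => hB.
set m := (l %/ 36)%N in hB.
have eB : B = take (size B - m) B ++ drop (size B - m) B by rewrite cat_take_drop.
have /(@prefix_form_not_suffix l) : prefix_form (winv (drop (size B - m) B)).
  by apply: (H _ (winv (take (size B - m) B) ++ C)); rewrite catA -winv_cat -eB.
move=> /(_ (A ++ take (size B - m) B) nl); rewrite winvK size_winv size_drop.
rewrite -catA -eB; apply => //; rewrite -/m; lia.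
Qed.

(** Induction on the factors. Either [u] is a prefix of [X l], or [u = A ++ C'] is [X l] times the
    prefix [winv B ++ C'] of the remaining product. *)
Lemma prefix_Xprod ks u v : all (fun k => n <= k)%N ks -> Xprod ks = u ++ v ->
  prefix_form u.
Proof.
elim: ks u v => [|l ks IH] u v /=.
  by case: u => // _ _; exists [::], n0, 0%N; rewrite take0.
move=> /andP[nl hks]; have {}IH := fun u v => IH u v hks.
have [A [B [C [eA eB e sB]]]] := Xprod_decomp nl IH.
have lX := @speed l; have sX : size (X l) = (size A + size B)%N by rewrite eA size_cat.
rewrite -/(Xprod (l :: ks)) => eu.
have ru : reduced u by apply: (@reduced_catl _ u v); rewrite -eu reduced_Xprod.
rewrite {}e in eu.
have [uA|Au] := leqP (size u) (size A).
  exists [::], l, (size u); split=> //; first by lia.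
  by rewrite eA takel_cat // -(takel_cat C uA) eu take_size_cat // fmul0s.
have [C' [eu' eC]] : exists C', u = A ++ C' /\ C = C' ++ v.
  exists (drop (size A) u).
  have e1 : A = take (size A) u.
    by rewrite -(takel_cat v (ltnW Au)) -eu take_size_cat.
  rewrite {1}e1 cat_take_drop; split=> //.
  by move/(congr1 (drop (size A))): eu; rewrite drop_size_cat // drop_cat Au.
have su : size u = (size A + size C')%N by rewrite eu' size_cat.
have /IH[ks' [k [i [hks' hk hs hi e']]]] : Xprod ks = (winv B ++ C') ++ v.
  by rewrite eB eC catA.
rewrite size_cat size_winv in hs hi.
(* The sum grows by [l] and the length by [size A - size B], which is at least [l/4 - 2 * l/36],
   hence at least [l/8]. *)
exists (l :: ks'), k, i; split=> //=; [by rewrite nl|lia|lia|].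
rewrite -fmulA -e' eA /fmul -[LHS](reduce_id ru) eu' -catA.
have := reduce_winv_catK (winv B) C'; rewrite winvK => eBC.
by rewrite -[in RHS]reduce_catr eBC reduce_catr.
Qed.

(** The first factor has at least [l/4] letters and loses fewer than [l/36], so [A] is nonempty. *)
Lemma Xprod_neq0 ks : ks != [::] -> all (fun k => n <= k)%N ks -> Xprod ks <> [::].
Proof.
case: ks => // l ks _ /= /andP[nl hks] e0.
have [A [B [C [eA eB e sB]]]] :=
  Xprod_decomp nl (fun u v => @prefix_Xprod ks u v hks).
have lX := @speed l; have sX : size (X l) = (size A + size B)%N by rewrite eA size_cat.
move/(congr1 size): e; rewrite [LHS](congr1 size e0) /= size_cat; lia.
Qed.

End Path.

(** * Averages over uniform words *)

Section Average.
Variables (R : realType) (d : nat).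
Hypothesis d_gt4 : (4 < d)%N.
Implicit Types (f g : seq (letter d) -> R) (s u : seq (letter d)).

(** The expectation of [f] over [l] independent uniform letters, as a finite iterated mean. *)
Fixpoint avg (l : nat) f : R :=
  if l is l'.+1 then (2 * d)%:R^-1 * \sum_a avg l' (fun s => f (a :: s))
  else f [::].

Lemma avg_le l f g : (forall s, size s = l -> f s <= g s) -> avg l f <= avg l g.
Proof.
elim: l f g => [|l IH] f g h /=; first exact: h.
rewrite ler_wpM2l ?invr_ge0 ?ler0n //; apply: ler_sum => a _.
by apply: IH => s hs; apply: h; rewrite /= hs.
Qed.

Lemma eq_avg l f g : (forall s, size s = l -> f s = g s) -> avg l f = avg l g.
Proof. by move=> h; apply/eqP; rewrite eq_le !avg_le // => s /h ->. Qed.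

Lemma avg_sum (I : Type) (r : seq I) l (F : I -> seq (letter d) -> R) :
  avg l (fun s => \sum_(i <- r) F i s) = \sum_(i <- r) avg l (F i).
Proof.
elim: l F => //= l IH F; under eq_bigr do rewrite IH.
by rewrite exchange_big mulr_sumr.
Qed.

Lemma avgZ l c f : avg l (fun s => c * f s) = c * avg l f.
Proof.
elim: l f => //= l IH f; under eq_bigr do rewrite IH.
by rewrite -mulr_sumr mulrCA.
Qed.

Lemma avg_cat j t f : avg (j + t) f = avg j (fun s => avg t (fun s' => f (s ++ s'))).
Proof. by elim: j f => //= j IH f; congr (_ * _); apply: eq_bigr => a _; rewrite IH. Qed.

Lemma card_letter : #|{: letter d}| = (2 * d)%N.
Proof. by rewrite card_prod card_ord card_bool mulnC. Qed.

Let d2_gt0 : 0 < (2 * d)%:R :> R. Proof. by rewrite ltr0n; lia. Qed.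

Lemma avg_cst l (c : R) : avg l (fun=> c) = c.
Proof.
elim: l => //= l ->; rewrite sumr_const card_letter -[c *+ _]mulr_natl mulKf //.
by rewrite gt_eqF.
Qed.

(* With weight 3^-|r| the mean over one step is at most
   ((2d - 1)/3 + 3) / 2d <= 3/5; this is where d > 4 enters. *)
Lemma sum_red_cons s :
  \sum_(a : letter d) (3^-1 : R) ^+ size (red_cons a s) <=
  (2 * d)%:R * (3 / 5 * 3^-1 ^+ size s).
Proof.
have d5 : 5 <= d%:R :> R by rewrite ler_nat.
case: s => [|y s] /=.
  rewrite sumr_const card_letter -[X in X <= _]mulr_natl expr0 expr1 natrM; lra.
rewrite (bigD1 (linv y)) //= linvK eqxx.
rewrite (eq_bigr (fun=> 3^-1 ^+ (size s).+2)) => [|a ha]; last first.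
  by rewrite ifN //; apply: contra ha => /eqP ->; rewrite linvK.
rewrite sumr_const; have -> : #|(fun a : letter d => a != linv y)| = (2 * d).-1.
  by have := cardC1 (linv y); rewrite card_letter => <-; apply: eq_card.
have : 0 < (3^-1 : R) ^+ size s by rewrite exprn_gt0 // invr_gt0.
rewrite !exprS; move: (_ ^+ size s) => e e0 /=; rewrite -[X in _ + X <= _]mulr_natl.
have -> : ((2 * d).-1)%:R = 2 * d%:R - 1 :> R.
  by rewrite -subn1 natrB ?natrM //; lia.
have : 0 <= e * (d%:R - 5) by rewrite mulr_ge0 ?subr_ge0 // ltW.
rewrite natrM; lra.
Qed.

(** Each prepended letter contributes a factor [3 / 5] by [sum_red_cons]. *)
Lemma avg_pow_size l u :
  avg l (fun s => 3^-1 ^+ size (reduce (s ++ u))) <=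
  (3 / 5) ^+ l * 3^-1 ^+ size (reduce u).
Proof.
elim: l => [|l IH] /=; first by rewrite expr0 mul1r.
rewrite ler_pdivrMl // -avg_sum exprS.
apply: (@le_trans _ _ (avg l (fun s => (2 * d)%:R * (3 / 5) *
    3^-1 ^+ size (reduce (s ++ u))))).
  by apply: avg_le => s _; rewrite -mulrA; exact: sum_red_cons.
by rewrite avgZ -!mulrA ler_pM2l // ler_pM2l // ler_pM2l // invr_gt0.
Qed.

(** On this event [s ++ u] reduces to the empty word, of weight 1, so [avg_pow_size] bounds its
    probability. *)
Lemma avg_reduce_eq l u : reduced u ->
  avg l (fun s => (reduce s == winv u)%:R) <= 3^-1 ^+ size u.
Proof.
move=> ru; apply: le_trans (_ : (3 / 5) ^+ l * 3^-1 ^+ size u <= _).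
  rewrite -{2}(reduce_id ru); apply: le_trans (avg_pow_size l u); apply: avg_le => s _.
  case: eqP => [es|_]; last by rewrite exprn_ge0 // invr_ge0.
  by rewrite -reduce_catl es -[u in _ ++ u]cats0 reduce_winv_catK.
rewrite ler_piMl ?exprn_ge0 ?invr_ge0 //.
by rewrite exprn_ile1 //; lra.
Qed.

(** Markov's inequality for the weight: [4 * size < l] gives [3 ^ size <= (4/3) ^ l] since
    [3 <= (4/3)^4], and [4/3 * 3/5 = 4/5]. *)
Lemma avg_slow l : avg l (fun s => (slow l s)%:R) <= (4 / 5) ^+ l.
Proof.
apply: (@le_trans _ _ (avg l (fun s => (4 / 3) ^+ l * 3^-1 ^+ size (reduce s)))).
  apply: avg_le => s _; have t0 : 0 <= (3^-1 : R) ^+ size (reduce s).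
    by rewrite exprn_ge0 // invr_ge0.
  rewrite /slow; case: ltnP => [h|_] /=; last first.
    by rewrite mulr_ge0 // exprn_ge0 //; lra.
  rewrite [leLHS](_ : _ = 3 ^+ size (reduce s) * 3^-1 ^+ size (reduce s)); last first.
    by rewrite -exprMn divff ?expr1n // pnatr_eq0.
  rewrite ler_wpM2r //.
  apply: (@le_trans _ _ ((4 / 3) ^+ (4 * size (reduce s)))).
    rewrite exprM; apply: lerXn2r; rewrite ?nnegrE ?exprn_ge0 //; try lra.
  by apply: ler_weXn2l; [lra|exact: ltnW].
rewrite avgZ [leRHS](_ : _ = (4 / 3) ^+ l * (3 / 5) ^+ l); last first.
  by rewrite -[RHS]exprMn; congr (_ ^+ _); field.
have e43 : 0 < 4 / 3 :> R by lra.
rewrite ler_pM2l ?exprn_gt0 //.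
have := avg_pow_size l [::]; rewrite expr0 mulr1 => h; apply: le_trans _ h.
by apply: avg_le => s _; rewrite cats0.
Qed.

Lemma avg_has (I : eqType) (r : seq I) l (p : I -> pred (seq (letter d))) (c : R) :
  (forall i, i \in r -> avg l (fun s => (p i s)%:R) <= c) ->
  avg l (fun s => (has (p^~ s) r)%:R) <= (size r)%:R * c.
Proof.
move=> h; apply: (@le_trans _ _ (avg l (fun s => \sum_(i <- r) (p i s)%:R))).
  apply: avg_le => s _; elim: r {h} => [|i r IH] /=; first by rewrite big_nil.
  rewrite big_cons; case: (p i s) => /=; last by rewrite add0r.
  by rewrite lerDl sumr_ge0.
rewrite avg_sum big_seq; apply: (@le_trans _ _ (\sum_(i <- r | i \in r) c)).
  exact: ler_sum.
by rewrite -big_seq big_const_seq count_predT iter_addr_0 mulr_natl.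
Qed.

(** Conditionally on the first [j] letters [u] is fixed, and [avg_reduce_eq] applies to the
    remaining ones. *)
Lemma avg_hit l m ks k i j : (j <= l)%N ->
  avg l (fun s => (hit m ks k i j s)%:R) <= 3^-1 ^+ m.
Proof.
move=> jl; rewrite -(subnKC jl) avg_cat -[leRHS](avg_cst j); apply: avg_le => s sj.
rewrite /hit; under eq_avg do rewrite take_size_cat // drop_size_cat //.
case: eqP => [<-|_] /=; last by rewrite avg_cst exprn_ge0 // invr_ge0.
by apply: avg_reduce_eq; exact: reduced_fmul.
Qed.

(** * Counting lists, and the probability of bad words *)

Lemma sum_pow_iota a c : \sum_(k <- iota a c) (12 / 13 : R) ^+ k <= 13 * (12 / 13) ^+ a.
Proof.
elim: c a => [|c IH] a /=.
  by rewrite big_nil mulr_ge0 // exprn_ge0 //; lra.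
rewrite big_cons; have := IH a.+1; rewrite exprS.
move: (\sum_(_ <- _) _) (_ ^+ a) => A B; lra.
Qed.

(** Splitting off the first entry [k] bounds the left side by [1 + 2 * 13 * (12/13)^60], and
    [(12/13)^60 <= 1/32]. *)
Lemma size_lists_up_to (f M : nat) :
  (size (lists_up_to f M))%:R * (12 / 13) ^+ M <= 2 :> R.
Proof.
elim: f M => [|f IH] M /=; first by rewrite mul0r; lra.
have x0 : 0 <= 12 / 13 :> R by lra.
rewrite -add1n natrD mulrDl mul1r size_flatten /shape -map_comp sumnE big_map.
rewrite natr_sum mulr_suml.
apply: (@le_trans _ _ (1 + \sum_(k <- iota 60 (M.+1 - 60)) 2 * (12 / 13) ^+ k)).
  apply: lerD; first by rewrite exprn_ile1 //; lra.
  rewrite big_seq [leRHS]big_seq; apply: ler_sum => k.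
  rewrite mem_iota => hk /=; rewrite size_map.
  have -> : (12 / 13 : R) ^+ M = (12 / 13) ^+ (M - k) * (12 / 13) ^+ k.
    by rewrite -exprD; congr (_ ^+ _); lia.
  by rewrite mulrA ler_wpM2r // exprn_ge0.
rewrite -mulr_sumr; have := sum_pow_iota 60 (M.+1 - 60).
have : (12 / 13 : R) ^+ 60 <= 1 / 32.
  have h : (12 / 13 : R) ^+ 12 <= 1 / 2 by rewrite !exprS expr0; lra.
  rewrite (exprM _ 12 5); apply: (@le_trans _ _ ((1 / 2) ^+ 5)).
    by apply: lerXn2r; rewrite ?nnegrE ?exprn_ge0 //; lra.
  by rewrite !exprS expr0; lra.
move: (\sum_(_ <- _) _) ((12 / 13) ^+ 60) => A B; lra.
Qed.

Lemma size_lists_up_to8 (f m : nat) : (size (lists_up_to f (8 * m)))%:R <= 2 * 2 ^+ m :> R.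
Proof.
have := size_lists_up_to f (8 * m); rewrite exprM.
have : (1 / 2 : R) ^+ m <= ((12 / 13) ^+ 8) ^+ m.
  by apply: lerXn2r; rewrite ?nnegrE ?exprn_ge0 //; rewrite ?exprS ?expr0; lra.
move: (((12 / 13) ^+ 8) ^+ m) (size _) => y N h1 h2.
have e : 1 = (1 / 2) ^+ m * 2 ^+ m :> R by rewrite -exprMn divfK ?expr1n // pnatr_eq0.
rewrite -[leLHS]mulr1 [X in _ * X <= _]e mulrA ler_wpM2r ?exprn_ge0 //.
by apply: le_trans h2; rewrite ler_wpM2l // ler0n.
Qed.

Lemma bernoulli (x : R) m : 0 <= 1 + x -> x * m%:R + 1 <= (1 + x) ^+ m.
Proof.
move=> x0; elim: m => [|m IH]; first by rewrite mulr0 add0r expr0.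
rewrite exprS -natr1; apply: (@le_trans _ _ ((1 + x) * (x * m%:R + 1))).
  have := ler0n R m; nra.
by rewrite ler_wpM2l.
Qed.

Lemma avg_bad_div l : avg l (fun s => (bad l s)%:R) <= 576 * 10 ^+ 3 * (8 / 9) ^+ (l %/ 36).
Proof.
set m := (l %/ 36)%N.
have h : avg l (fun s => (bad l s)%:R) <=
    (size (lists_up_to (8 * m).+1 (8 * m)))%:R *
    ((8 * m).+1%:R * (m.+1%:R * (l.+1%:R * 3^-1 ^+ m))) :> R.
  apply: avg_has => ks _.
  rewrite -[X in X%:R * (_ * _)](size_iota 0); apply: avg_has => k _.
  rewrite -[X in X%:R * (_ * _)](size_iota 0); apply: avg_has => i _.
  rewrite -[X in X%:R * _](size_iota 0); apply: avg_has => j.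
  by rewrite mem_iota => jl; apply: avg_hit; lia.
apply: le_trans h _.
have t0 : 0 <= (3^-1 : R) ^+ m by rewrite exprn_ge0 // invr_ge0.
(* Bernoulli's inequality lets [q] absorb the three linear factors of the union bound. The rate
   becomes [2 * (11/10)^3 / 3 <= 8/9], with constant [576 = 2 * 8 * 36] times [10^3]. *)
pose q : R := 10 * (11 / 10) ^+ m.
have hq : m.+1%:R <= q.
  have -> : q = 10 * (1 + 1 / 10) ^+ m by congr (_ * _ ^+ _); field.
  have x0 : 0 <= 1 + 1 / 10 :> R by lra.
  have := bernoulli m x0; rewrite -[m.+1%:R]natr1.
  by move: (_ ^+ m) => e; lra.
have q0 : 0 <= q by apply: le_trans hq; rewrite ler0n.
have h8 : (8 * m).+1%:R <= 8 * q :> R.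
  apply: (@le_trans _ _ (8 * m.+1%:R)); last by rewrite ler_wpM2l.
  by rewrite -natrM ler_nat; lia.
have h36 : l.+1%:R <= 36 * q :> R.
  apply: (@le_trans _ _ (36 * m.+1%:R)); last by rewrite ler_wpM2l.
  by rewrite -natrM ler_nat /m; lia.
apply: (@le_trans _ _ (2 * 2 ^+ m * (8 * q * (q * (36 * q * 3^-1 ^+ m))))).
  apply: ler_pM; rewrite ?mulr_ge0 ?ler0n //; first exact: size_lists_up_to8.
  apply: ler_pM; rewrite ?mulr_ge0 ?ler0n //.
  apply: ler_pM; rewrite ?mulr_ge0 ?ler0n //.
  by rewrite ler_wpM2r.
apply: (@le_trans _ _ (576 * 10 ^+ 3 * (2 * (11 / 10) ^+ 3 / 3) ^+ m)).
  rewrite [(2 * _ / 3) ^+ m]exprMn [(2 * _) ^+ m]exprMn exprAC /q.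
  rewrite le_eqVlt; apply/orP; left; apply/eqP.
  by move: ((11 / 10) ^+ m) (2 ^+ m) (3^-1 ^+ m) => a b c; ring.
rewrite ler_wpM2l //; apply: lerXn2r; rewrite ?nnegrE //; rewrite ?exprS ?expr0; lra.
Qed.

Lemma avg_bad l : avg l (fun s => (bad l s)%:R) <= 10 ^+ 6 * (1 - 1 / 324) ^+ l.
Proof.
apply: le_trans (avg_bad_div l) _; set m := (l %/ 36)%N; set p : R := 1 - 1 / 324.
have p0 : 0 <= p by rewrite /p; lra.
(* Bernoulli again, with [36 / 324 = 1 / 9]; this turns decay in [l %/ 36] into decay in [l]. *)
have hp : 8 / 9 <= p ^+ 36.
  have := @bernoulli (- (1 / 324)) 36; rewrite -/p => /(_ p0); lra.
have h : (8 / 9) ^+ m.+1 <= p ^+ l.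
  apply: (@le_trans _ _ ((p ^+ 36) ^+ m.+1)).
    by apply: lerXn2r; rewrite ?nnegrE ?exprn_ge0 //; lra.
  rewrite -exprM ler_wiXn2l // /p; try lra.
  by rewrite /m; lia.
move: h; rewrite exprS; have : 0 <= (8 / 9 : R) ^+ m by rewrite exprn_ge0 //; lra.
move: (_ ^+ m) (_ ^+ l) => a b; lra.
Qed.

End Average.

(** * Borel-Cantelli *)

Lemma measure_bigsetU_le (dT : measure_display) (T : measurableType dT)
    (R : realType) (mu : {measure set T -> \bar R}) (I : Type) (r : seq I)
    (F : I -> set T) : (forall i, measurable (F i)) ->
  (mu (\big[setU/set0]_(i <- r) F i) <= \sum_(i <- r) mu (F i))%E.
Proof.
move=> mF; elim: r => [|i r IH]; first by rewrite !big_nil measure0.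
rewrite !big_cons; apply: le_trans; last exact: (leeD2l _ IH).
by apply: measureU2 => //; exact: bigsetU_measurable.
Qed.

(** * From averages over words to probabilities *)

Section Law.
Variables (d : nat) (R : realType) (dT : measure_display) (T : measurableType dT).
Variables (P : probability T R) (zeta : nat -> T -> letter d).
Hypothesis d_gt4 : (4 < d)%N.
Hypothesis zeta_meas : forall i (a : letter d), measurable [set w | zeta i w = a].
Hypothesis zeta_unif : forall i (a : letter d),
  P [set w | zeta i w = a] = ((2 * d)%:R^-1)%:E.
Hypothesis zeta_indep : forall (I : seq nat), uniq I -> forall a : nat -> letter d,
  P (\bigcap_(i in [set` I]) [set w | zeta i w = a i]) =
  (\prod_(i <- I) P [set w | zeta i w = a i])%E.

Let seg j l w := [seq zeta i w | i <- iota j l].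

Lemma seg_eqE a : [set w | seg 0 (size a) w = a] =
  \bigcap_(i in [set` iota 0 (size a)])
     [set w | zeta i w = nth (Ordinal (ltn_trans (isT : 0 < 4)%N d_gt4), true) a i].
Proof.
set x0 := (_, true); apply/seteqP; split => w /=.
  move=> e i /=; rewrite mem_iota => hi /=; rewrite -e (nth_map 0%N) ?size_iota //.
  by rewrite nth_iota.
move=> h; apply: (@eq_from_nth _ x0); first by rewrite size_map size_iota.
rewrite size_map size_iota => i hi; rewrite (nth_map 0%N) ?size_iota // nth_iota //.
by apply: h => /=; rewrite mem_iota.
Qed.

Lemma measurable_seg_eq a : measurable [set w | seg 0 (size a) w = a].
Proof. by rewrite seg_eqE; apply: bigcap_measurableType. Qed.

Lemma prob_seg_eq a :
  P [set w | seg 0 (size a) w = a] = ((2 * d)%:R^-1 ^+ size a)%:E.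
Proof.
rewrite seg_eqE zeta_indep ?iota_uniq //; under eq_bigr do rewrite zeta_unif.
by rewrite prodEFin big_const_seq count_predT size_iota iter_mulr_1.
Qed.

Let word_set (A : pred (seq (letter d))) l a :=
  [set w | seg 0 (size a) w = a /\ A (a ++ seg (size a) l w)].

(** The past [a] is kept arbitrary so that the event can be split according to the next letter, by
    induction on [l]. *)
Lemma word_set_bound A l a : measurable (word_set A l a) /\
  (P (word_set A l a) <=
   ((2 * d)%:R^-1 ^+ size a * avg l (fun s => (A (a ++ s))%:R))%:E)%E.
Proof.
elim: l a => [|l IH] a.
  rewrite /word_set /= cats0; case: (A a).
    rewrite (_ : [set w | _ /\ _] = [set w | seg 0 (size a) w = a]); last first.
      by apply/seteqP; split=> w /=; [case|].
    by rewrite prob_seg_eq mulr1; split=> //; exact: measurable_seg_eq.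
  rewrite (_ : [set w | _ /\ _] = set0); last first.
    by apply/seteqP; split=> w /=; [case|].
  by rewrite measure0 mulr0.
have E : word_set A l.+1 a = \big[setU/set0]_b word_set A l (rcons a b).
  have seg_S w : seg 0 (size a).+1 w = rcons (seg 0 (size a) w) (zeta (size a) w).
    by rewrite /seg -addn1 iotaD map_cat cats1.
  rewrite -bigcup_seq; apply/seteqP; split => w.
    move=> [e h]; exists (zeta (size a) w); first by rewrite /= mem_index_enum.
    by rewrite /word_set /= size_rcons seg_S e cat_rcons.
  move=> [b _]; rewrite /word_set /= size_rcons seg_S cat_rcons => -[+ h].
  by move/rcons_inj => -[e eb]; split=> //; rewrite /seg /= eb.
rewrite E; split; first by apply: bigsetU_measurable => b _; case: (IH (rcons a b)).
have mE b : measurable (word_set A l (rcons a b)) by case: (IH (rcons a b)).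
apply: le_trans (measure_bigsetU_le _ _ mE) _.
apply: (@le_trans _ _ (\sum_b ((2 * d)%:R^-1 ^+ (size a).+1 *
    avg l (fun s => (A (a ++ b :: s))%:R))%:E)%E).
  apply: lee_sum => b _; have [_] := IH (rcons a b); rewrite size_rcons.
  by under [X in (_ <= (_ * X)%:E)%E -> _]eq_avg do rewrite cat_rcons.
by rewrite sumEFin -mulr_sumr /= exprSr mulrA.
Qed.

Lemma prob_word (A : pred (seq (letter d))) l :
  measurable [set w | A (seg 0 l w)] /\
  (P [set w | A (seg 0 l w)] <= (avg l (fun s => (A s)%:R))%:E)%E.
Proof.
have := word_set_bound A l [::]; rewrite expr0 mul1r /=.
by rewrite (_ : word_set _ _ _ = [set w | A (seg 0 l w)]) //; apply/seteqP; split => w //= [].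
Qed.

Let F l := [set w | slow l (seg 0 l w) || bad l (seg 0 l w)].

Lemma prob_F l : measurable (F l) /\
  (P (F l) <= (2 * 10 ^+ 6 * (1 - 1 / 324) ^+ l)%:E)%E.
Proof.
have [m1 p1] := prob_word (slow l) l; have [m2 p2] := prob_word (bad l) l.
have -> : F l = [set w | slow l (seg 0 l w)] `|` [set w | bad l (seg 0 l w)].
  by apply/seteqP; split => w /orP.
split; first exact: measurableU.
apply: le_trans (measureU2 _ m1 m2) _; apply: le_trans (leeD p1 p2) _.
rewrite -EFinD lee_fin; have := avg_slow R d_gt4 l; have := avg_bad R d_gt4 l.
have : (4 / 5 : R) ^+ l <= (1 - 1 / 324) ^+ l.
  by apply: lerXn2r; rewrite ?nnegrE; lra.
have : 0 <= (1 - 1 / 324 : R) ^+ l by rewrite exprn_ge0 //; lra.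
move: (_ ^+ l) (_ ^+ l) => a b; lra.
Qed.

Lemma lim_sup_F : P (lim_sup_set F) = 0.
Proof.
apply: lim_sup_set_cvg0 => [l|]; first by case: (prob_F l).
apply: (@le_lt_trans _ _ (2 * 10 ^+ 6 * 324)%:E); last by rewrite ltry.
apply: lime_le; first exact: is_cvg_nneseries.
apply: nearW => n; apply: (@le_trans _ _ (\sum_(0 <= l < n)
    (2 * 10 ^+ 6 * (1 - 1 / 324) ^+ l)%:E)%E).
  by apply: lee_sum => l _; case: (prob_F l).
rewrite sumEFin lee_fin.
(* Closed form of the geometric sum, with [324] the inverse of one minus the ratio. *)
apply: (@le_trans _ _ (2 * 10 ^+ 6 * (324 * (1 - (1 - 1 / 324) ^+ n)))).
  elim: n => [|n IH]; first by rewrite big_nil expr0 subrr !mulr0.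
  rewrite big_nat_recr //= [_ ^+ n.+1]exprS; move: IH; move: (\sum_(_ <= _ < _) _) (_ ^+ n) => A B.
  lra.
have : 0 <= (1 - 1 / 324 : R) ^+ n by rewrite exprn_ge0 //; lra.
lra.
Qed.

End Law.

Theorem mainTheorem11 (d : nat) (hd : (4 < d)%N)
  (R : realType) (dT : measure_display) (T : measurableType dT)
  (P : probability T R) (zeta : nat -> T -> letter d)
  (zeta_meas : forall i (a : letter d), measurable [set w | zeta i w = a])
  (zeta_unif : forall i (a : letter d),
     P [set w | zeta i w = a] = ((2 * d)%:R^-1)%:E)
  (zeta_indep : forall (I : seq nat), uniq I -> forall a : nat -> letter d,
     P (\bigcap_(i in [set` I]) [set w | zeta i w = a i]) =
     (\prod_(i <- I) P [set w | zeta i w = a i])%E) :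
  exists n : nat, (0 < n)%N /\
    ~ {ae P, forall w, forall g : seq (letter d), reduced g ->
           in_semigroup (fun k => walk zeta k w) n g}.
Proof.
apply: contrapT => H.
have L0 := lim_sup_F hd zeta_meas zeta_unif zeta_indep.
set F := fun l : nat => _ in L0.
have mF l : measurable (F l) by have [] := prob_F hd zeta_meas zeta_unif zeta_indep l.
have aeF : {ae P, forall w, ~ lim_sup_set F w}.
  exists (lim_sup_set F); split => //; last by move=> w /= /contrapT.
  apply: bigcap_measurableType => k _; exact: bigcup_measurable.
(* Specialise the negated claim to the identity element; the successor meets the requirement of a
   positive index. *)
have aeS n : {ae P, forall w, in_semigroup (fun k => walk zeta k w) n.+1 [::]}.
  have : {ae P, forall w, forall g : seq (letter d), reduced g ->
           in_semigroup (fun k => walk zeta k w) n.+1 g}.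
    by apply: contrapT => h; apply: H; exists n.+1.
  by apply: filterS => w; apply.
have : \forall w \ae P, False.
  (* The threshold [n0] depends on [w], so all [n] must be handled on one event of full measure. *)
  have aeS' := ae_foralln aeS.
  apply: filterS2 aeF aeS' => w hF hS; apply: hF => n0 _; apply: contrapT => hn0.
  have ok l : (n0 <= l)%N -> ~ F l w by move=> hl Fl; apply: hn0; exists l.
  have [ks [ks0 [hks]]] := hS (60 + 5 * n0)%N.
  apply/nesym; apply: (@Xprod_neq0 d (zeta^~ w) n0 _ _ (60 + 5 * n0).+1) => //.
  - by move=> l /ok /negP; rewrite negb_or => /andP[].
  - by move=> l /ok /negP; rewrite negb_or => /andP[].
move=> [N [mN N0 NT]].
have : (P setT <= 0)%E by rewrite -N0; apply: le_measure; rewrite ?inE // => w _; apply: NT.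
by rewrite probability_setT lee_fin ler10.
Qed.
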